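(* Let $(B,+,\circ)$ be a non-trivial skew brace in which $(B,+)$ is locally cyclic and torsion-free. Let $K=\operatorname{Ker}(\lambda)$ and consider $(B,+)$ as a subgroup of $(\mathbb Q,+)$ containing the rational number $1$. Then one of the following possibilities holds: (1a) $K$ is a non-zero ideal of $B$ such that $|B/K|=2$, $(B,+)$ is not $2$-divisible, and $a\circ b=a+(-1)^{\varphi(a+K)}b$ for all $a,b\in B$, where $\varphi:(B/K,+)\to\mathbb Z_2$ is an isomorphism. Thus $(B,\circ)$ is isomorphic to the dihedral group $\mathbb Z_2\ltimes(B,+)$. In this case, $B$ is not Dedekind. (1b) $K=\{0\}$, $(B,\circ)$ is abelian, and there exists a non-zero rational number $\frac{m_1}{m_2}\in B$ (with $m_1,m_2$ integers) such that: (i) $\gcd(m_1,m_2)=1$, $m_2>0$, and $m_2-m_1\neq 0,\pm1$; (ii) $(B,+)$ is $p$-divisible for every prime $p$ that does not divide $m_1-m_2$; (iii) $(B,+)$ is not $(m_2-m_1)$-divisible; (iv) $\frac{-a}{1-a+\frac{m_1}{m_2}a}\in B$, $(m_2-m_1)ab\in B$, and $a\circ b=a+b-ab+\frac{m_1}{m_2}ab$ for all $a,b\in B$. In this case, $(B,+)$ is isomorphic to (the additive group of) a sub-ring of $\mathbb Q$. Moreover, $B$ is not Dedekind. Conversely, let $(X,+)$ be any subgroup of $(\mathbb Q,+)$ containing the rational number $1$. (2a) If $X$ is not $2$-divisible, then a group $(X,\circ_1)$ can be defined by putting $x\circ_1y=x+(-1)^{\varphi(x+2X)}y$ for all $x,y\in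 X$, where $\varphi:X/2X\to\mathbb Z_2$ is an isomorphism. Then $(X,+,\circ_1)$ is a skew brace with $\operatorname{Ker}(\lambda)=2X\neq\{0\}$. (2b) If $X$ is a sub-ring of $\mathbb Q$ for which there exists a non-zero rational number $\frac{m_1}{m_2}$ (with $m_1,m_2$ integers) satisfying (i) $\gcd(m_1,m_2)=1$, $m_2>0$, and $m_2-m_1\neq0,\pm1$; (ii) $(X,+)$ is $p$-divisible for every prime $p$ that does not divide $m_1-m_2$; (iii) $(X,+)$ is not $(m_2-m_1)$-divisible; then the operation $x\circ_2y=x+y-xy+\frac{m_1}{m_2}xy$ ($x,y\in X$) defines an abelian group $(X,\circ_2)$, and $(X,+,\circ_2)$ is a skew brace with $\operatorname{Ker}(\lambda)=\{0\}$.
   Context: A skew brace is a triple $(B,+,\circ)$ with $(B,+)$, $(B,\circ)$ (not necessarily abelian) groups such that $a\circ(b+c)=a\circ b-a+a\circ c$ for all $a,b,c\in B$. The identities of the two groups coincide and are denoted by $0$. For $a\in B$ put $\lambda_a(b)=-a+a\circ b$; then $\lambda:a\mapsto\lambda_a$ is a homomorphism $(B,\circ)\to\operatorname{Aut}(B,+)$ with kernel $\operatorname{Ker}(\lambda)$. $B$ is trivial if $a+b=a\circ b$ for all $a,b\in B$. A sub-skew brace is a subset that is a subgroup of both $(B,+)$ and $(B,\circ)$. An ideal is a subgroup of $(B,+)$ that is normal in $(B,+)$, invariant under all $\lambda_b$, and normal in $(B,\circ)$. $B$ is Dedekind if all its sub-skew braces are ideals of $B$. A group is locally cyclic if every finitely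 generated subgroup is cyclic; every non-zero torsion-free locally cyclic group is isomorphic to a subgroup of $(\mathbb Q,+)$ containing $1$. An additive abelian group $A$ is $n$-divisible if $nA=A$. $\mathbb Z_2$ is the cyclic group of order $2$. In the dihedral group $\mathbb Z_2\ltimes(B,+)$ the generator of $\mathbb Z_2$ acts on $(B,+)$ by inversion. Products such as $ab$ are products of rational numbers. *)

(* Defs.v *)
From mathcomp Require Export all_boot all_order all_algebra.
From mathcomp Require Export boolp classical_sets functions cardinality.

Set Implicit Arguments.
Unset Strict Implicit.
Unset Printing Implicit Defensive.

Import GRing.Theory.

Local Open Scope classical_set_scope.
Local Open Scope ring_scope.

(* Group laws are unbundled from their carrier (unlike groupType or zmodType)
   because a skew brace carries two of them, neither assumed commutative. *)
Record groupLaw (T : Type) := GroupLaw {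
  gop :> T -> T -> T;
  gid : T;
  ginv : T -> T;
  gopA : associative gop;
  gop1l : left_id gid gop;
  gopVl : left_inverse gid ginv gop }.

Definition zmodLaw (V : zmodType) : groupLaw V :=
  GroupLaw (@addrA V) (@add0r V) (@addNr V).

Section GroupNotions.
Variables (T : Type) (G : groupLaw T).
Implicit Types (A C D H : set T) (a b x y : T).

(* The multiple n a, in additive notation. *)
Definition gmulz (n : int) a : T :=
  match n with
  | Posz k => iter k (G a) (gid G)
  | Negz k => ginv G (iter k.+1 (G a) (gid G))
  end.

Definition subgroup H : Prop :=
  [/\ H (gid G), forall a b, H a -> H b -> H (G a b)
    & forall a, H a -> H (ginv G a)].

Definition normal_subgroup H : Prop :=
  subgroup H /\ forall a h, H h -> H (G (G a h) (ginv G a)).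

Definition abelian_law : Prop := commutative G.

Definition generated A : set T := smallest subgroup A.

Definition locally_cyclic : Prop :=
  forall A, finite_set A -> exists g, generated A = generated [set g].

Definition torsion_free : Prop :=
  forall (n : nat) a, (0 < n)%N -> gmulz n a = gid G -> a = gid G.

Definition multiples (n : int) A : set T := [set gmulz n a | a in A].

Definition divisible (n : int) A : Prop := multiples n A = A.

Definition coset H a : set T := [set G a h | h in H].

(* A / H as a set of cosets; when H is normal its group law is set_op. *)
Definition quotient A H : set (set T) := [set coset H a | a in A].

Definition set_op C D : set T := [set G x y | x in C & y in D].

(* Only the restriction of phi to A / H is constrained. *)
Definition quotient_iso_Z2 A H (phi : set T -> 'Z_2) : Prop :=
  set_bij (quotient A H) [set: 'Z_2] phi /\
  forall C D, quotient A H C -> quotient A H D ->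
    phi (set_op C D) = phi C + phi D.

(* The law of the semidirect product of 'Z_2 acting on T by inversion. *)
Definition dihedral_op (u v : 'Z_2 * T) : 'Z_2 * T :=
  (u.1 + v.1, G u.2 (if u.1 == 0 then v.2 else ginv G v.2)).

End GroupNotions.

Lemma gmulz_zmodLaw (V : zmodType) (n : int) (x : V) :
  gmulz (zmodLaw V) n x = x *~ n.
Proof.
have E k : iter k (zmodLaw V x) (gid (zmodLaw V)) = x *+ k.
  by elim: k => [|k IHk]; rewrite ?mulr0n // iterS IHk mulrS.
by case: n => k; rewrite /gmulz E.
Qed.

Record skewBrace (T : Type) := SkewBrace {
  badd : groupLaw T;
  bcirc : groupLaw T;
  bcirc_badd : forall a b c,
    bcirc a (badd b c) = badd (badd (bcirc a b) (ginv badd a)) (bcirc a c) }.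

Section SkewBraceNotions.
Variables (T : Type) (B : skewBrace T).
Implicit Types (I S : set T).

Definition lambda (a b : T) : T := badd B (ginv (badd B) a) (bcirc B a b).

Definition ker_lambda : set T := [set a | forall b, lambda a b = b].

Definition trivial_brace : Prop := forall a b, badd B a b = bcirc B a b.

Definition sub_skew_brace S : Prop :=
  subgroup (badd B) S /\ subgroup (bcirc B) S.

Definition ideal I : Prop :=
  [/\ normal_subgroup (badd B) I, forall b a, I a -> I (lambda b a)
    & normal_subgroup (bcirc B) I].

Definition dedekind : Prop := forall S, sub_skew_brace S -> ideal S.

End SkewBraceNotions.

(* iota identifies (T, +) with a subgroup of (Q, +) containing 1. *)
Definition rat_embedding (T : Type) (G : groupLaw T) (iota : T -> rat) : Prop :=
  [/\ injective iota, forall a b, iota (G a b) = iota a + iota b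
    & range iota 1].

(* Main.v *)
From HB Require Import structures.
From mathcomp Require Import lra ring zify.
Require Import Defs.

Set Implicit Arguments.
Unset Strict Implicit.
Unset Printing Implicit Defensive.

Import Order.TTheory GRing.Theory Num.Theory.

Local Open Scope classical_set_scope.
Local Open Scope card_scope.
Local Open Scope ring_scope.

(** Identify the additive group with a subgroup X of the rationals containing 1.
An additive endomorphism of X is multiplication by a rational, so the skew
brace is described by a multiplier l from X to the non-zero rationals, through
a o b = a + l(a) b.  Associativity says l(a + l(a) b) = l(a) l(b), and the
kernel K of lambda is the set where l = 1.

If K contains some k <> 0, then l is K-periodic.  Some multiple n a of a is in
K, and all the circle powers of a lie in the group H of the x with n x in K.
The quotient H / K is finite: it has exponent dividing n, and finitely many
elements of H have a common generator.  So two circle powers of a are congruent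
modulo K, and l(a)^i = l(a)^j for some i <> j.  As l(a) is rational, it is 1 or
-1 ([multiplier_sign]).  Then l is a homomorphism from the additive group to the
signs, with kernel K = 2X ([ker_double]), whence the dihedral structure
([dihedral_isomorphism]).  For c outside K, the multiples of 3c form a sub-skew
brace that is not normal for the circle law ([sign_not_dedekind]).

If K = 0, then l is injective, so the circle group embeds in the multiplicative
group of the rationals and is abelian.  Exchanging a and 1 in a + l(a) b gives
l(a) = 1 + c a with c = l(1) - 1.  Write l(1) = m1 / m2 in lowest terms.  Since
the values of l act invertibly on X, evaluating l at suitable integers yields
divisibility by all integers coprime to m1 - m2 ([stable_div_coprime]), and
since l does not vanish, X does not contain 1 / (m2 - m1) ([stable_not_div]).
The ring of the rationals r with rX contained in X lies between (m2 - m1) X and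
X, which makes it of the form e X ([subring_multiple]): this is the subring
isomorphic to X.  For a prime p not dividing m1 - m2, the elements a such that
c a has positive p-adic valuation form a sub-skew brace that is not stable
under lambda, because X is p-divisible ([zero_ker_not_dedekind]).

Conversely a function l on X with the above identity, and with suitable closure
properties, defines a skew brace ([multiplier_brace]).  This is applied to the
sign given by the class modulo 2X, and to l(x) = 1 + c x; in the latter case
the point is that -x / (1 + c x) is in X, which is checked one prime factor of
the denominator at a time ([subring_quasi_inverse]). *)

(** * Subgroups of the rationals *)

Lemma rat_commensurable (x y : rat) : x != 0 ->
  exists2 n : nat, (0 < n)%N & exists k : int, n%:R * y = k%:~R * x.
Proof.
move=> x0; exists `|denq (y / x)|%N; first by rewrite absz_gt0 denq_neq0.
exists (numq (y / x)); rewrite pmulrn absz_denq numqE.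
by rewrite mulrAC divfK// mulrC.
Qed.

Section RatSubgroup.
Variable X : set rat.
Hypothesis sX : subgroup (zmodLaw rat) X.

Lemma rsub0 : X 0. Proof. by case: sX. Qed.

Lemma rsubD x y : X x -> X y -> X (x + y).
Proof. by case: sX => _ + _; apply. Qed.

Lemma rsubN x : X x -> X (- x).
Proof. by case: sX => _ _; apply. Qed.

Lemma rsubB x y : X x -> X y -> X (x - y).
Proof. by move=> Xx Xy; apply: rsubD => //; apply: rsubN. Qed.

Lemma rsubZ (n : int) x : X x -> X (n%:~R * x).
Proof.
move=> Xx; rewrite mulrzl.
have Xn k : X (x *+ k).
  by elim: k => [|k IHk]; rewrite ?mulr0n ?mulrS; [apply: rsub0|apply: rsubD].
by case: n => k; [apply: Xn|apply: rsubN; apply: Xn].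
Qed.

(** Bezout: x is an integral combination of n x and k x. *)
Lemma rsub_coprime (n k : int) x :
  coprimez n k -> X (n%:~R * x) -> X (k%:~R * x) -> X x.
Proof.
move=> /coprimezP[[u v] /= uv1] Xn Xk.
have -> : x = u%:~R * (n%:~R * x) + v%:~R * (k%:~R * x).
  by rewrite !mulrA -mulrDl -!intrM -intrD uv1 mul1r.
by apply: rsubD; apply: rsubZ.
Qed.

(** Over a common denominator, h is the gcd of the two numerators; by Bezout it is
an integral combination of x and y, hence belongs to X. *)
Lemma common_generator2 x y : X x -> X y ->
  exists h, [/\ X h, exists k : int, x = k%:~R * h
                   & exists k : int, y = k%:~R * h].
Proof.
move=> Xx Xy.
have [[p s] [D D0 [xE yE]]] : exists ps : int * int, exists2 D : rat, D != 0 &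
    x = ps.1%:~R / D /\ y = ps.2%:~R / D.
  have dx : (denq x)%:~R != 0 :> rat by rewrite intr_eq0 denq_neq0.
  have dy : (denq y)%:~R != 0 :> rat by rewrite intr_eq0 denq_neq0.
  exists (numq x * denq y, numq y * denq x).
  exists ((denq x)%:~R * (denq y)%:~R); first by rewrite mulf_neq0.
  split; rewrite intrM.
    by rewrite -[LHS]divq_num_den; field; rewrite dx dy.
  by rewrite -[LHS]divq_num_den; field; rewrite dx dy.
have [u [v uvE]] := Bezoutz p s.
exists ((gcdz p s)%:~R / D); split.
- have -> : (gcdz p s)%:~R / D = u%:~R * x + v%:~R * y.
    by rewrite xE yE -uvE intrD !intrM /=; field.
  by apply: rsubD; apply: rsubZ.
- by exists (p %/ gcdz p s)%Z; rewrite xE mulrA -intrM divzK ?dvdz_gcdl.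
- by exists (s %/ gcdz p s)%Z; rewrite yE mulrA -intrM divzK ?dvdz_gcdr.
Qed.

Lemma common_generator (N : nat) (x : nat -> rat) :
  (forall i, (i < N)%N -> X (x i)) ->
  exists2 h, X h & forall i, (i < N)%N -> exists k : int, x i = k%:~R * h.
Proof.
elim: N => [|N IHN] Xx; first by exists 0; [exact: rsub0|].
have [i iN|h Xh hx] := IHN; first exact/Xx/ltnW.
have [g [Xg [k hE] [k' xE]]] := common_generator2 Xh (Xx N (ltnSn N)).
exists g => // i; rewrite ltnS leq_eqVlt => /orP[/eqP->|iN]; first by exists k'.
by have [z ->] := hx i iN; exists (z * k); rewrite hE mulrA intrM.
Qed.

Lemma rdivisibleP (n : int) : n != 0 ->
  divisible (zmodLaw rat) n X <-> forall x, X x -> X (x / n%:~R).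
Proof.
move=> n0; have n0' : n%:~R != 0 :> rat by rewrite intr_eq0.
split=> [dX x|dX].
  rewrite -{1}dX => -[y Xy]; rewrite gmulz_zmodLaw => <-.
  by rewrite -mulrzr mulfK.
apply/seteqP; split=> x /=.
  by case=> y Xy; rewrite gmulz_zmodLaw -mulrzl => <-; apply: rsubZ.
move=> Xx; exists (x / n%:~R); first exact: dX.
by rewrite gmulz_zmodLaw -mulrzr divfK.
Qed.

Lemma rdoubleE x : multiples (zmodLaw rat) 2 X x <-> X (x / 2).
Proof.
split=> [[y Xy]|Xx].
  rewrite gmulz_zmodLaw => <-; suff -> : y *~ 2 / 2 = y by [].
  by rewrite -mulrzr; field.
by exists (x / 2) => //; rewrite gmulz_zmodLaw -mulrzr; field.
Qed.

(** Both x and c are odd multiples of a common generator, so their sum is an even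
one: this is why 2X has index at most 2 in X. *)
Lemma rdouble_index2 c x : X c -> ~ X (c / 2) -> X x -> ~ X (x / 2) ->
  X ((x + c) / 2).
Proof.
move=> Xc c2 Xx x2; have [h [Xh [k cE] [j xE]]] := common_generator2 Xc Xx.
have hodd (n : int) y : y = n%:~R * h -> ~ X (y / 2) ->
    exists q : int, y = (2 * q + 1)%:~R * h.
  move=> yE y2; exists (n %/ 2)%Z; rewrite yE; congr (_%:~R * _).
  rewrite {1}(divz_eq n 2); suff : (n %% 2)%Z != 0 by lia.
  apply/eqP => n0; apply: y2; rewrite yE (divz_eq n 2) n0 addr0 intrM.
  have -> : (n %/ 2)%Z%:~R * 2%:~R * h / 2 = (n %/ 2)%Z%:~R * h :> rat by field.
  exact: rsubZ.
have [q ->] := hodd _ _ cE c2; have [q' ->] := hodd _ _ xE x2.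
suff -> : ((2 * q' + 1)%:~R * h + (2 * q + 1)%:~R * h) / 2 =
   (q' + q + 1)%:~R * h by apply: rsubZ.
by rewrite !intrD !intrM; field.
Qed.

End RatSubgroup.

(** The subring is the ring R of the rationals r with r X contained in X.  It
satisfies dX <= R <= X, and such a group is some eX because X / dX is cyclic:
here e is the least positive integer with eX <= R. *)
Lemma subring_multiple (X : set rat) (d : int) :
  subgroup (zmodLaw rat) X -> X 1 -> d != 0 ->
  (forall a b, X a -> X b -> X (d%:~R * a * b)) ->
  exists2 e : nat, (0 < e)%N &
    GRing.subring_closed (mem [set e%:R * x | x in X]).
Proof.
move=> sX X1 d0 dX; pose R := [set r : rat | forall x, X x -> X (r * x)].
have sR : subgroup (zmodLaw rat) R.
  split=> [x _|r s Rr Rs x Xx|r Rr x Xx].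
  - by rewrite mul0r; apply: rsub0.
  - by rewrite mulrDl; apply: rsubD; [|apply: Rr|apply: Rs].
  - by rewrite mulNr; apply: rsubN; [|apply: Rr].
pose P (e : nat) := (0 < e)%N /\ forall x, X x -> R (e%:R * x).
have exP : exists e, `[< P e >].
  exists `|d|%N; apply/asboolP; split=> [|x Xx y Xy]; first by rewrite absz_gt0.
  rewrite pmulrn abszE; have [_|_] := ger0P d; first exact: dX.
  by rewrite intrN !mulNr; apply: rsubN => //; apply: dX.
case: (ex_minnP exP) => e /asboolP[e0 eR] emin.
(* If gX is not contained in R for any g with 0 < g < e, write r and a witness
   y g for each such g as multiples of one h; then r = n h with e dividing n,
   since otherwise g = gcd(n, e) gives g h in R and hence g (y g) in R. *)
have Re r : R r -> exists2 x, X x & e%:R * x = r.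
  move=> Rr; have Xr : X r by rewrite -[r]mulr1; apply: Rr.
  have [y yP] : {y : nat -> rat & forall g, X (y g) /\
      ((0 < g < e)%N -> ~ R (g%:R * y g))}.
    apply: (@choice _ _ (fun g y => X y /\ ((0 < g < e)%N -> ~ R (g%:R * y)))) => g.
    apply: contrapT => /forallNP nP.
    have Xg x : X x -> ~ ((0 < g < e)%N -> ~ R (g%:R * x)).
      by move=> Xx gx; apply: (nP x).
    have /not_implyP[/andP[g0 ge] _] := Xg 1 X1.
    have : (e <= g)%N.
      apply: emin; apply/asboolP; split=> // x /Xg/not_implyP[_].
      exact: contrapT.
    by rewrite leqNgt ge.
  pose z i := if i == 0 then r else y i.
  have Xz i : (i < e)%N -> X (z i).
    by rewrite /z; case: eqP => // _ _; case: (yP i).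
  have [h Xh zh] := common_generator sX Xz.
  have [n rn] := zh 0 e0; rewrite /z eqxx in rn.
  have [eg|ge] := eqVneq (gcdz n e) e.
    have /dvdzP[q nq] : (e %| n)%Z by rewrite -eg dvdz_gcdl.
    exists (q%:~R * h); first exact: rsubZ.
    by rewrite rn nq intrM; ring.
  pose g := gcdn `|n| e.
  have g0 : (0 < g)%N by rewrite gcdn_gt0 e0 orbT.
  have {}ge : (g < e)%N.
    rewrite ltn_neqAle dvdn_leq ?dvdn_gcdr// andbT.
    by apply: contraNneq ge => ge; rewrite /gcdz -/g ge.
  have [u [v uv]] := Bezoutz n e.
  have Rgh : R (g%:R * h).
    have -> : g%:R * h = u%:~R * (n%:~R * h) + v%:~R * (e%:R * h).
      have -> : g%:R = (gcdz n e)%:~R :> rat by [].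
      by rewrite -uv intrD !intrM; ring.
    by apply: (rsubD sR); apply: (rsubZ sR); rewrite -?rn//; apply: eR.
  have [k yk] := zh g ge; rewrite /z gtn_eqF// in yk.
  have [_ []] := yP g; first by rewrite g0.
  by rewrite yk mulrCA; apply: (rsubZ sR).
have RE : [set e%:R * x | x in X] = R.
  by apply/seteqP; split=> [_ [x Xx <-]|r /Re//]; apply: eR.
exists e => //; rewrite RE; split=> [|r s|r s]; rewrite !inE.
- by move=> x Xx; rewrite mul1r.
- exact: (rsubB sR).
- by move=> Rr Rs x Xx; rewrite -mulrA; apply: Rr; apply: Rs.
Qed.

(** The hypotheses are those satisfied by the range of the embedding when the
multiplier is l(a) = 1 + c a: it never vanishes, and it acts invertibly. *)
Section MultiplierStable.
Variables (X : set rat) (m1 m2 : int).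
Let c : rat := (m1 - m2)%:~R / m2%:~R.
Hypotheses (sX : subgroup (zmodLaw rat) X) (X1 : X 1).
Hypotheses (m2_neq0 : m2 != 0) (cX_neq0 : forall a, X a -> 1 + c * a != 0).
Hypothesis (cX : forall a x, X a -> X x <-> X ((1 + c * a) * x)).

Let m2_rat : m2%:~R != 0 :> rat. Proof. by rewrite intr_eq0. Qed.

(** If u p + v (m1 - m2) = 1, the multiplier takes the value u p at the integer
k = - m2 v; dividing by this value and multiplying by u divides by p. *)
Lemma stable_div_coprime (p : int) x :
  coprimez p (m1 - m2) -> X x -> X (x / p%:~R).
Proof.
move=> /coprimezP[[u v] /= uv] Xx.
have [p0|p0] := eqVneq p 0; first by rewrite p0 invr0 mulr0; apply: rsub0.
have p0' : p%:~R != 0 :> rat by rewrite intr_eq0.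
pose k : rat := (- (m2 * v))%:~R.
have Xk : X k by rewrite /k -[_%:~R]mulr1; apply: rsubZ.
have kE : 1 + c * k = u%:~R * p%:~R.
  have {}uv : u%:~R * p%:~R + v%:~R * (m1 - m2)%:~R = 1 :> rat.
    by rewrite -!intrM -intrD uv.
  have -> : u%:~R * p%:~R = 1 - v%:~R * (m1 - m2)%:~R :> rat.
    by apply/eqP; rewrite eq_sym subr_eq eq_sym uv.
  by rewrite /k /c intrN intrM; field.
have u0 : u%:~R != 0 :> rat.
  by have := cX_neq0 Xk; rewrite kE mulf_eq0 negb_or => /andP[].
have -> : x / p%:~R = u%:~R * (x / (1 + c * k)) by rewrite kE; field; rewrite ?u0 ?p0'.
apply: rsubZ => //; apply/(cX _ Xk).
by rewrite mulrC divfK ?cX_neq0.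
Qed.

(** The element m2 / (m2 - m1) is the zero of 1 + c a. *)
Lemma stable_not_div : m2 - m1 != 0 -> ~ X (1 / (m2 - m1)%:~R).
Proof.
move=> d0 Xd; have := cX_neq0 (rsubZ sX m2 Xd); rewrite /c; apply/negP/negPn.
have d0' : (m2 - m1)%:~R != 0 :> rat by rewrite intr_eq0.
rewrite -opprB intrN; move: d0' m2_rat; move: _%:~R m2%:~R => D M D0 M0.
by apply/eqP; field; rewrite D0.
Qed.

(** Up to the factor - m2, this is c a b = (1 + c b) a - a. *)
Lemma stable_mul a b : X a -> X b -> X ((m2 - m1)%:~R * a * b).
Proof.
move=> Xa Xb; have := rsubB sX Xb ((cX b Xa).1 Xb).
move=> /(rsubZ sX m2); congr (X _); rewrite /c !intrB.
by field.
Qed.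

End MultiplierStable.

(** * Embedding a torsion-free locally cyclic group into the rationals *)

Section GroupLawTheory.
Variables (T : Type) (G : groupLaw T).

Lemma gopI a : injective (G a).
Proof.
by move=> b c /(congr1 (G (ginv G a))); rewrite !gopA gopVl !gop1l.
Qed.

Lemma gopV a : G a (ginv G a) = gid G.
Proof.
apply: (@gopI (ginv G a)); rewrite gopA gopVl gop1l.
by apply: (@gopI (ginv G (ginv G a))); rewrite !gopA !gopVl gop1l.
Qed.

Lemma gop1 a : G a (gid G) = a.
Proof. by rewrite -(gopVl G a) gopA gopV gop1l. Qed.

Lemma gopVK a b : G a (G (ginv G a) b) = b.
Proof. by rewrite gopA gopV gop1l. Qed.

Lemma sub_generated A : A `<=` generated G A.
Proof. by move=> a Aa S [_]; apply. Qed.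

Lemma generated_le A S : subgroup G S -> A `<=` S -> generated G A `<=` S.
Proof. by move=> sS AS a; apply. Qed.

Lemma centraliser_subgroup a : subgroup G [set b | G a b = G b a].
Proof.
split=> [|b c|b] /=; first by rewrite gop1 gop1l.
  by move=> ab ac; rewrite gopA ab -gopA ac gopA.
move=> ab; apply: (@gopI b); rewrite gopVK gopA -ab -gopA gopV gop1.
by [].
Qed.

(** The centraliser of g contains g, hence <g>; so the centraliser of any element of
<g> contains g, hence <g>. *)
Lemma generated_cyclic_abelian g a b :
  generated G [set g] a -> generated G [set g] b -> G a b = G b a.
Proof.
have cg c : generated G [set g] c -> G g c = G c g.
  by move=> gc; apply: (generated_le (centraliser_subgroup g) _ gc) => _ ->.
move=> ga gb; apply: (generated_le (centraliser_subgroup a) _ gb) => _ -> /=.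
by rewrite cg.
Qed.

Lemma locally_cyclic_abelian : locally_cyclic G -> abelian_law G.
Proof.
move=> cG a b; have [g gE] := cG _ (finite_set2 a b).
by apply: (@generated_cyclic_abelian g); rewrite -gE; apply: sub_generated;
  [left|right].
Qed.

End GroupLawTheory.

Section AbelianLaw.
Variables (T : Type) (G : groupLaw T) (cG : abelian_law G).

(** The proof of commutativity is a parameter so that the Z-module structure can be
attached to the carrier. *)
Definition abelian_carrier of abelian_law G := T.
Local Notation V := (abelian_carrier cG).

HB.instance Definition _ := gen_eqMixin V.
HB.instance Definition _ := gen_choiceMixin V.
HB.instance Definition _ :=
  GRing.isZmodule.Build V (@gopA T G) cG (@gop1l T G) (@gopVl T G).

Lemma gmulz_abelian (n : int) (a : V) : gmulz G n a = a *~ n.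
Proof. exact: (gmulz_zmodLaw n a). Qed.

Lemma abelian_generated1 (g a : V) : generated G [set g : T] a ->
  exists n : int, a = g *~ n.
Proof.
move=> ga; suff sg : subgroup G [set b | exists n : int, b = g *~ n].
  by apply: (generated_le sg _ ga) => _ ->; exists 1.
split=> [|_ _ [n ->] [k ->]|_ [n ->]]; first by exists 0.
  by exists (n + k); rewrite mulrzDr.
by exists (- n); rewrite mulrNz.
Qed.

Hypotheses (lG : locally_cyclic G) (tG : torsion_free G).

Lemma torsion_free_mulrz (a : V) (n : int) : n != 0 -> a *~ n = 0 -> a = 0.
Proof.
move=> n0 an0; apply: (tG (n := `|n|%N)); first by rewrite absz_gt0.
rewrite gmulz_abelian abszE; have [_|_] := ger0P n; first exact: an0.
by rewrite mulrNz an0 oppr0.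
Qed.

Lemma commensurable (g a : V) : g != 0 ->
  exists2 n : int, n != 0 & exists k : int, a *~ n = g *~ k.
Proof.
move=> g0; have [h hE] := lG (finite_set2 (g : T) a).
have [n gn] : exists n : int, g = (h : V) *~ n.
  by apply: abelian_generated1; rewrite -hE; apply: sub_generated; left.
have [k ak] : exists n : int, a = (h : V) *~ n.
  by apply: abelian_generated1; rewrite -hE; apply: sub_generated; right.
exists n; first by apply: contraNneq g0 => n0; rewrite gn n0 mulr0z.
by exists k; rewrite gn ak -!mulrzA mulrC.
Qed.

(** The embedding sends g to 1, and a to k / n when n a = k g; the fraction is
determined by a, and determines a, because there is no torsion. *)
Lemma abelian_rat_embedding (g : V) : g != 0 ->
  exists iota : T -> rat, rat_embedding G iota.
Proof.
move=> g0.
pose R (a : V) (r : rat) := exists2 n : int, n != 0 & exists2 k : int,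
  a *~ n = g *~ k & r = k%:~R / n%:~R.
have ir (n : int) : n != 0 -> n%:~R != 0 :> rat by rewrite intr_eq0.
have Runiq a r s : R a r -> R a s -> r = s.
  move=> [n n0 [k ank ->]] [n' n'0 [k' ank' ->]].
  suff kn : k * n' = k' * n.
    by apply/eqP; rewrite eqr_div ?ir// -!intrM kn.
  apply/eqP; rewrite -subr_eq0; apply: contraNT g0 => /torsion_free_mulrz gE.
  apply/eqP/gE.
  by rewrite mulrzBr !mulrzA -ank -ank' -!mulrzA mulrC subrr.
have RI a b r : R a r -> R b r -> a = b.
  move=> [n n0 [k ank ->]] [n' n'0 [k' ank' /eqP]].
  rewrite eqr_div ?ir// -!intrM eqr_int => /eqP kn.
  apply/eqP; rewrite -subr_eq0; apply/eqP.
  apply: (@torsion_free_mulrz _ (n * n')); first by rewrite mulf_neq0.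
  rewrite mulrzBl mulrzA ank mulrC (mulrzA b) ank' -!mulrzA.
  by rewrite kn subrr.
have [iota iotaR] : {iota : V -> rat & forall a, R a (iota a)}.
  apply: choice => a; have [n n0 [k ank]] := commensurable a g0.
  by exists (k%:~R / n%:~R); exists n => //; exists k.
exists iota; split.
- by move=> a b ab; apply: (RI a b (iota a)) => //; rewrite ab.
- move=> a b; apply: (Runiq (G a b) _ _ (iotaR (G a b))).
  have [n n0 [k ank ->]] := iotaR a; have [n' n'0 [k' ank' ->]] := iotaR b.
  exists (n * n'); first by rewrite mulf_neq0.
  exists (k * n' + k' * n); last by rewrite addf_div ?ir// !intrM intrD !intrM.
  rewrite (mulrzDl _ (a : V) b) mulrzA ank mulrC (mulrzA (b : V)) ank' -!mulrzA.
  by rewrite -mulrzDr.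
- exists g => //; apply: (Runiq g); first exact: iotaR.
  by exists 1 => //; exists 1.
Qed.

End AbelianLaw.

Lemma locally_cyclic_rat_embedding (T : Type) (G : groupLaw T) (g : T) :
  locally_cyclic G -> torsion_free G -> g <> gid G ->
  exists iota : T -> rat, rat_embedding G iota.
Proof.
move=> lG tG g0; have cG := locally_cyclic_abelian lG.
by apply: (abelian_rat_embedding (cG := cG) lG tG (g := g)); apply/eqP.
Qed.

Section Embedding.
Variables (T : Type) (G : groupLaw T).

Section Morphism.
Variables (V : zmodType) (f : T -> V).
Hypothesis fD : forall a b, f (G a b) = f a + f b.

Lemma morph_gid : f (gid G) = 0.
Proof. by apply: (@addrI _ (f (gid G))); rewrite -fD gop1l addr0. Qed.

Lemma morph_ginv a : f (ginv G a) = - f a.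
Proof.
by apply: (@addrI _ (f a)); rewrite -fD gopV morph_gid subrr.
Qed.

Lemma morph_gmulz n a : f (gmulz G n a) = f a *~ n.
Proof.
have fn k : f (iter k (G a) (gid G)) = f a *+ k.
  by elim: k => [|k IHk]; rewrite ?morph_gid//= fD IHk mulrS.
by case: n => k; rewrite /gmulz ?morph_ginv fn.
Qed.

End Morphism.

Variable iota : T -> rat.
Hypothesis emb : rat_embedding G iota.

Let iotaI : injective iota. Proof. by case: emb. Qed.
Let iotaD a b : iota (G a b) = iota a + iota b. Proof. by case: emb. Qed.

Lemma range_subgroup : subgroup (zmodLaw rat) (range iota).
Proof.
split=> [|_ _ [a _ <-] [b _ <-]|_ [a _ <-]].
- by exists (gid G) => //; rewrite morph_gid.
- by exists (G a b).
- by exists (ginv G a) => //; rewrite morph_ginv.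
Qed.

Lemma image_subgroup H : subgroup G H ->
  subgroup (zmodLaw rat) [set iota a | a in H].
Proof.
case=> H0 HD HV; split=> [|_ _ [a Ha <-] [b Hb <-]|_ [a Ha <-]].
- by exists (gid G); rewrite ?morph_gid.
- by exists (G a b); rewrite ?iotaD//; apply: HD.
- by exists (ginv G a); rewrite ?morph_ginv//; apply: HV.
Qed.

(** If q iota(a) = p then q a = p u, so that q f(a) = p f(u). *)
Lemma embedded_linear (u : T) (f : T -> rat) : iota u = 1 ->
  (forall a b, f (G a b) = f a + f b) -> forall a, f a = f u * iota a.
Proof.
move=> u1 fD a.
have q0 : (denq (iota a))%:~R != 0 :> rat by rewrite intr_eq0 denq_neq0.
have qa : gmulz G (denq (iota a)) a = gmulz G (numq (iota a)) u.
  apply: iotaI; rewrite !morph_gmulz// u1 -mulrzr.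
  by rewrite -{1}[iota a]divq_num_den divfK.
have := congr1 f qa; rewrite !(morph_gmulz fD) -(mulrzr (f a)) -(mulrzr (f u)) => fqa.
rewrite -[in RHS](divq_num_den (iota a)); move: q0 fqa.
by move: (f a) (f u) _%:~R _%:~R => x y n d d0 xd; rewrite mulrA -xd mulfK.
Qed.

Lemma embedded_abelian : abelian_law G.
Proof. by move=> a b; apply: iotaI; rewrite !iotaD addrC. Qed.

Lemma embedded_divisible (n : int) :
  divisible G n [set: T] <-> divisible (zmodLaw rat) n (range iota).
Proof.
split=> dG.
  apply/seteqP; split=> [_ [_ [a _ <-] <-]|_ [a _ <-]].
    by exists (gmulz G n a) => //; rewrite morph_gmulz// gmulz_zmodLaw.
  have : multiples G n setT a by rewrite dG.
  case=> b _ <-; exists (iota b); first exact: imageP.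
  by rewrite morph_gmulz// gmulz_zmodLaw.
apply/seteqP; split=> // a _.
have : range iota (iota a) by exists a.
rewrite -{1}dG => -[_ [b _ <-]]; rewrite gmulz_zmodLaw -morph_gmulz// => /iotaI.
by exists b.
Qed.

End Embedding.

(** * Quotients of order two *)

Lemma Z2_cases (e : 'Z_2) : e = 0 \/ e = 1.
Proof. by case: e => [[|[|//]] ?]; [left|right]; apply: val_inj. Qed.

Section QuotientZ2.
Variables (T : Type) (G : groupLaw T) (A H : set T).
Hypotheses (cG : abelian_law G) (sA : subgroup G A) (sH : subgroup G H).
Hypothesis (HA : H `<=` A).

Lemma coset_refl a : coset G H a a.
Proof. by case: sH => H0 _ _; exists (gid G); rewrite ?gop1. Qed.

Lemma coset_eq a h : H h -> coset G H (G a h) = coset G H a.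
Proof.
case: sH => H0 HD HV Hh; apply/seteqP; split=> _ [k Hk <-].
  by exists (G h k); rewrite ?gopA//; apply: HD.
exists (G (ginv G h) k); first by apply: HD => //; apply: HV.
by rewrite -gopA gopVK.
Qed.

Lemma set_op_coset a b :
  set_op G (coset G H a) (coset G H b) = coset G H (G a b).
Proof.
case: sH => H0 HD _; apply/seteqP; split=> [_ [_ [h Hh <-] [_ [k Hk <-] <-]]|_ [h Hh <-]].
  exists (G h k); first exact: HD.
  by rewrite -!gopA; congr (G a _); rewrite !gopA (cG h b).
exists (G a (gid G)); first by exists (gid G).
exists (G b h); first by exists h.
by rewrite gop1 gopA.
Qed.

(** A homomorphism onto Z/2 with kernel H is constant on the cosets of H, and phi
reads its value off any element of the coset. *)
Lemma quotient_iso_of_parity (chi : T -> 'Z_2) c :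
  (forall a b, A a -> A b -> chi (G a b) = chi a + chi b) ->
  (forall a, A a -> H a <-> chi a = 0) -> A c -> chi c = 1 ->
  exists phi, quotient_iso_Z2 G A H phi /\
    forall a, A a -> phi (coset G H a) = chi a.
Proof.
move=> chiD chi0 Ac chic; have [A0 AD AV] := sA.
pose phi (C : set T) : 'Z_2 := if `[< exists2 a, C a & chi a = 1 >] then 1 else 0.
have phiE a : A a -> phi (coset G H a) = chi a.
  move=> Aa; rewrite /phi; case: asboolP => [[_ [h Hh <-]]|na].
    by rewrite chiD ?(chi0 h _).1 ?addr0//; apply: HA.
  have [->//|chia] := Z2_cases (chi a); case: na; exists a => //.
  exact: coset_refl.
exists phi; split=> //; split; last first.
  move=> _ _ [a Aa <-] [b Ab <-].
  by rewrite set_op_coset !phiE ?chiD//; apply: AD.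
split=> //.
- move=> _ _ /set_mem[a Aa <-] /set_mem[b Ab <-]; rewrite !phiE// => chiab.
  have : H (G (ginv G a) b).
    apply/chi0; first by apply: AD => //; apply: AV.
    rewrite chiD -?chiab -?chiD ?gopVl//; try exact: AV.
    by apply/chi0 => //; case: sH.
  by move=> /(coset_eq a); rewrite gopVK.
- move=> e _; have [->|->] := Z2_cases e.
    exists (coset G H (gid G)); first by exists (gid G).
    by rewrite phiE//; apply/chi0 => //; case: sH.
  by exists (coset G H c); [exists c|rewrite phiE].
Qed.

Lemma quotient_iso_parity phi : quotient_iso_Z2 G A H phi ->
  (forall a b, A a -> A b ->
     phi (coset G H (G a b)) = phi (coset G H a) + phi (coset G H b)) /\
  (forall a, A a -> H a <-> phi (coset G H a) = 0).
Proof.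
move=> [[_ phiI _] phiD]; have [A0 AD AV] := sA.
have qA a : A a -> quotient G A H (coset G H a) by exists a.
have pD a b : A a -> A b ->
     phi (coset G H (G a b)) = phi (coset G H a) + phi (coset G H b).
  by move=> Aa Ab; rewrite -phiD ?set_op_coset//; apply: qA.
have p0 : phi (coset G H (gid G)) = 0.
  by apply: (@addrI _ (phi (coset G H (gid G)))); rewrite -pD// gop1 addr0.
split=> // a Aa; split=> [Ha|pa].
  by rewrite -(gop1l G a) coset_eq.
have /phiI : phi (coset G H a) = phi (coset G H (gid G)) by rewrite pa p0.
move=> /(_ (mem_set (qA _ Aa)) (mem_set (qA _ A0))) aE.
by have := coset_refl a; rewrite aE => -[h Hh <-]; rewrite gop1l.
Qed.

Lemma quotient_iso_card phi : quotient_iso_Z2 G A H phi ->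
  quotient G A H #= `I_2.
Proof.
move=> [[_ phiI phiS] _]; apply/card_set_bijP.
exists (fun C => phi C : nat); split=> [C _|C D qC qD /val_inj|k /= k2].
- exact: ltn_ord (phi C).
- exact: phiI.
- by have [C qC pC] := phiS (inord k) I; exists C => //; rewrite pC inordK.
Qed.

End QuotientZ2.

(** * The multiplier of a skew brace with rational additive group *)

Section EmbeddedBrace.
Variables (T : Type) (B : skewBrace T) (iota : T -> rat) (u : T).
Hypotheses (emb : rat_embedding (badd B) iota) (iu : iota u = 1).

Let iotaI : injective iota. Proof. by case: emb. Qed.
Let iotaD a b : iota (badd B a b) = iota a + iota b. Proof. by case: emb. Qed.
Let iotaN a : iota (ginv (badd B) a) = - iota a. Proof. exact: morph_ginv. Qed.
Let iota0 : iota (gid (badd B)) = 0. Proof. exact: morph_gid. Qed.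
Let sX : subgroup (zmodLaw rat) (range iota).
Proof. exact: range_subgroup emb. Qed.
Let iotaX a : range iota (iota a). Proof. by exists a. Qed.

(** The automorphism lambda_a is multiplication by the image of lambda_a(1). *)
Definition multiplier a : rat := iota (lambda B a u).
Local Notation l := multiplier.
Local Notation K := (ker_lambda B).

Lemma lambdaE a b : iota (lambda B a b) = l a * iota b.
Proof.
apply: (embedded_linear emb (f := iota \o lambda B a)) => //= {}b c.
by rewrite -iotaD /lambda bcirc_badd -!gopA.
Qed.

Lemma circE a b : iota (bcirc B a b) = iota a + l a * iota b.
Proof. by rewrite -lambdaE iotaD iotaN addrA subrr add0r. Qed.

Lemma multiplierM a b : l (bcirc B a b) = l a * l b.
Proof.
have /(congr1 iota) := gopA (bcirc B) a b u.
by rewrite !circE iu !mulr1 mulrDr addrA => /addrI.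
Qed.

Lemma circ_gid : gid (bcirc B) = gid (badd B).
Proof.
apply: iotaI; have /(congr1 iota) := gop1l (bcirc B) (gid (badd B)).
by rewrite circE iota0 mulr0 addr0.
Qed.

Lemma multiplier0 : l (gid (badd B)) = 1.
Proof.
have /(congr1 iota) := gop1l (bcirc B) u.
by rewrite circ_gid circE iota0 iu mulr1 add0r.
Qed.

Lemma multiplierV a : l a * l (ginv (bcirc B) a) = 1.
Proof. by rewrite -multiplierM gopV circ_gid multiplier0. Qed.

Lemma multiplier_neq0 a : l a != 0.
Proof.
apply/negP => /eqP l0; have := multiplierV a; rewrite l0 mul0r => /eqP.
by rewrite eq_sym oner_eq0.
Qed.

Lemma multiplier_inv a : l (ginv (bcirc B) a) = (l a)^-1.
Proof.
by apply: (mulfI (multiplier_neq0 a)); rewrite multiplierV divff ?multiplier_neq0.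
Qed.

Lemma circ_ginvE a : iota (ginv (bcirc B) a) = - iota a / l a.
Proof.
have /(congr1 iota) := gopV (bcirc B) a.
rewrite circE circ_gid iota0 => /eqP; rewrite addrC addr_eq0 => /eqP lE.
by apply: (mulfI (multiplier_neq0 a)); rewrite lE mulrC divfK ?multiplier_neq0.
Qed.

Lemma range_multiplier a x : range iota x <-> range iota (l a * x).
Proof.
split=> [[b _ <-]|]; first by rewrite -lambdaE.
case=> b _ xE; have -> : x = (l a)^-1 * iota b by rewrite xE mulKf ?multiplier_neq0.
by rewrite -multiplier_inv -lambdaE.
Qed.

Lemma ker_lambdaE a : K a <-> l a = 1.
Proof.
split=> [/(_ u) La|l1 b]; first by rewrite /multiplier La.
by apply: iotaI; rewrite lambdaE l1 mul1r.
Qed.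

Lemma multiplier_nontrivial : ~ trivial_brace B -> exists a, l a <> 1.
Proof.
move=> nB; apply: contrapT => /forallNP l1; apply: nB => a b; apply: iotaI.
by rewrite circE iotaD (contrapT (l1 a)) mul1r.
Qed.

Lemma ker_subgroup : subgroup (badd B) (ker_lambda B).
Proof.
split=> [|a b|a]; rewrite ?ker_lambdaE; first exact: multiplier0.
  move=> la lb; suff -> : badd B a b = bcirc B a b by rewrite multiplierM la lb mulr1.
  by apply: iotaI; rewrite circE iotaD la mul1r.
move=> la; suff -> : ginv (badd B) a = ginv (bcirc B) a.
  by rewrite multiplier_inv la invr1.
by apply: iotaI; rewrite circ_ginvE iotaN la divr1.
Qed.

(** The multiplier is K-periodic because the two laws agree when the left operand
is in K. *)
Lemma multiplier_ker k a : K k -> l (badd B k a) = l a.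
Proof.
move=> /ker_lambdaE lk.
suff -> : badd B k a = bcirc B k a by rewrite multiplierM lk mul1r.
by apply: iotaI; rewrite circE iotaD lk mul1r.
Qed.

(** The element lambda_b(k) is the circle conjugate of k by b, and K is normal in the
circle group. *)
Lemma ker_lambda_stable b k : K k -> K (lambda B b k).
Proof.
move=> /ker_lambdaE lk; apply/ker_lambdaE.
have -> : lambda B b k = bcirc B (bcirc B b k) (ginv (bcirc B) b).
  apply: iotaI; rewrite lambdaE !circE multiplierM lk mulr1 circ_ginvE.
  by field; rewrite multiplier_neq0.
by rewrite !multiplierM lk mulr1 multiplierV.
Qed.

(** * Skew braces with a non-zero kernel *)

(** The circle powers A i of a satisfy l(A i) = l(a)^i.  By the pigeonhole principle
two of them are congruent modulo K, so that a power of l(a) with positive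
exponent is 1. *)
Lemma multiplier_sign k a : K k -> k <> gid (badd B) -> l a = 1 \/ l a = -1.
Proof.
move=> Kk k0.
have {}k0 : iota k != 0.
  by apply/eqP => k0'; apply: k0; apply: iotaI; rewrite k0' iota0.
have [[//|n] _ [z zE]] := rat_commensurable (iota a) k0.
pose KX := [set iota b | b in K].
have sK : subgroup (zmodLaw rat) KX.
  exact: image_subgroup emb _ ker_subgroup.
have KXl x : KX x -> KX (l a * x).
  move=> [b Kb <-]; exists (lambda B a b).
    exact: ker_lambda_stable.
  by rewrite lambdaE.
pose A i := iter i (bcirc B a) (gid (badd B)).
have lA i : l (A i) = l a ^+ i.
  elim: i => [|i IHi]; first by rewrite multiplier0.
  by rewrite /A iterS multiplierM exprS -IHi.
(* H / K has exponent n + 1, and any finite part of it is cyclic, so among any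
   n + 2 elements of H two are congruent modulo K. *)
pose H := [set x | KX (n.+1%:R * x)].
have sH : subgroup (zmodLaw rat) H.
  split=> [|x y Hx Hy|x Hx]; rewrite /H /=.
  - by rewrite mulr0; apply: rsub0.
  - by rewrite mulrDr; apply: rsubD.
  - by rewrite mulrN; apply: rsubN.
have HA i : H (iota (A i)).
  elim: i => [|i IHi]; first by rewrite iota0; apply: rsub0.
  rewrite /A iterS circE; apply: (rsubD sH).
    by rewrite /H /= zE; apply: rsubZ => //; exists k.
  by rewrite /H /= mulrCA; apply: KXl.
have [h Hh hA] := common_generator sH (fun i (_ : (i < n.+2)%N) => HA i).
have [c cE] : {c : 'I_n.+2 -> int & forall i : 'I_n.+2, iota (A i) = (c i)%:~R * h}.
  apply: (@choice _ _ (fun (i : 'I_n.+2) k => iota (A i) = k%:~R * h)) => i.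
  exact: hA (ltn_ord i).
pose f (i : 'I_n.+2) : 'I_n.+1 := inord `|(c i %% n.+1)%Z|%N.
have /injectivePn[i [j ij fij]] : ~~ injectiveb f.
  apply/negP => /injectiveP/leq_card; rewrite !card_ord; lia.
have KXij : KX (iota (A i) - iota (A j)).
  have : (n.+1 %| c i - c j)%Z.
    rewrite -eqz_mod_dvd; move/(congr1 (@nat_of_ord _)): fij; rewrite /f !inordK.
    - by move=> cij; apply/eqP; lia.
    - by have := ltz_pmod (c j) (isT : 0 < n.+1%:Z); lia.
    - by have := ltz_pmod (c i) (isT : 0 < n.+1%:Z); lia.
  move=> /dvdzP[q qE]; rewrite !cE -mulrBl -intrB qE intrM -mulrA.
  by apply: rsubZ.
have [b Kb bE] := KXij.
have lij : l a ^+ i = l a ^+ j.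
  rewrite -!lA -(multiplier_ker (A j) Kb).
  by congr multiplier; apply: iotaI; rewrite iotaD bE subrK.
have l0 := multiplier_neq0 a.
have {lij ij} [m m0 lm] : exists2 m, (0 < m)%N & l a ^+ m = 1.
  wlog lt_ij : i j ij lij {fij KXij bE} / (i < j)%N => [wl|].
    have [ij'|ji|/val_inj ij'] := ltngtP i j; first exact: (wl i j).
      by apply: (wl j i) => //; rewrite eq_sym.
    by rewrite ij' eqxx in ij.
  exists (j - i)%N; first by rewrite subn_gt0.
  by apply: (mulfI (expf_neq0 i l0)); rewrite -exprD subnKC 1?ltnW// mulr1.
have /eqP : `|l a| ^+ m = 1 by rewrite -normrX lm normr1.
rewrite pexpr_eq1// eqr_norml => /andP[/orP[]/eqP-> _]; by [left|right].
Qed.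

Section SignMultiplier.
Hypothesis l_sign : forall a, l a = 1 \/ l a = -1.

(** If l(a) = -1 and l(-a) were 1, then -a would be in K, and a as well. *)
Lemma multiplier_oppr a : l (ginv (badd B) a) = l a.
Proof.
have [la|la] := l_sign a.
  rewrite la; apply/ker_lambdaE.
  have [_ _] := ker_subgroup; apply; exact/ker_lambdaE.
have [lN|->//] := l_sign (ginv (badd B) a).
have /ker_lambdaE KN := lN.
have [_ _ /(_ _ KN)/ker_lambdaE] := ker_subgroup.
suff -> : ginv (badd B) (ginv (badd B) a) = a by rewrite la.
by apply: iotaI; rewrite !iotaN opprK.
Qed.

(** If l(a) = -1, then a + b = a o (-b), and l(-b) = l(b). *)
Lemma multiplierD a b : l (badd B a b) = l a * l b.
Proof.
have [la|la] := l_sign a.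
  by rewrite multiplier_ker ?la ?mul1r//; exact/ker_lambdaE.
rewrite -(multiplier_oppr b) -multiplierM; congr multiplier.
by apply: iotaI; rewrite circE iotaD iotaN la mulrN mulN1r opprK.
Qed.

Definition multiplier_parity a : 'Z_2 := if l a == 1 then 0 else 1.
Local Notation chi := multiplier_parity.

Lemma multiplier_parityE a : l a = (-1) ^+ chi a.
Proof.
by rewrite /chi; have [->|->] := l_sign a; rewrite ?eqxx// eq_sym -subr_eq0.
Qed.

Lemma multiplier_parityD a b : chi (badd B a b) = chi a + chi b.
Proof.
have N1 : (-1 == 1 :> rat) = false by [].
rewrite /chi multiplierD; have [->|->] := l_sign a; have [->|->] := l_sign b;
  rewrite ?mulr1 ?mul1r ?mulrN1 ?opprK ?eqxx ?N1 ?addr0 ?add0r//.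
by apply: val_inj.
Qed.

Lemma multiplier_parity0 a : K a <-> chi a = 0.
Proof.
rewrite ker_lambdaE /chi; case: eqP => //; split=> //.
Qed.

(** Twice an element has multiplier 1; conversely, if a in K were not a double then,
as 2X has index 2, a + c would be one, and c would belong to K. *)
Lemma ker_double c : ~ K c -> forall a, K a <-> range iota (iota a / 2).
Proof.
move=> Kc a; have double b d : iota d = iota b / 2 -> K b.
  move=> dE; have -> : b = badd B d d by apply: iotaI; rewrite iotaD dE; field.
  by apply/ker_lambdaE; rewrite multiplierD; have [->|->] := l_sign d.
split=> [Ka|[d _ dE]]; last exact: double dE.
apply: contrapT => a2; have c2 : ~ range iota (iota c / 2).
  by move=> [d _ dE]; apply: Kc; apply: double dE.
have [d _ dE] := rdouble_index2 sX (iotaX c) c2 (iotaX a) a2.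
apply: Kc; rewrite -iotaD in dE; move/double: dE.
by rewrite !ker_lambdaE multiplier_ker.
Qed.

(** As l(c) = -1, every a is uniquely 2h or 2h + c according to its parity; the
isomorphism maps a to the pair of its parity and h. *)
Lemma dihedral_isomorphism c : ~ K c ->
  exists f : T -> 'Z_2 * T, bijective f /\
    forall a b, f (bcirc B a b) = dihedral_op (badd B) (f a) (f b).
Proof.
move=> Kc; have chic : chi c = 1.
  by move: Kc; rewrite ker_lambdaE /chi; case: eqP.
pose z (e : 'Z_2) : rat := (e : nat)%:R.
have z0 : z 0 = 0 by [].
have z1 : z 1 = 1 by [].
have [half halfE] : {half : T -> T &
    forall a, iota a = iota (half a) *+ 2 + z (chi a) * iota c}.
  apply: (@choice _ _ (fun a d => iota a = iota d *+ 2 + z (chi a) * iota c)) => a.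
  have Kac : K (badd B a (if chi a == 0 then gid (badd B) else c)).
    apply/multiplier_parity0; rewrite multiplier_parityD.
    have [->|->] := Z2_cases (chi a); rewrite ?eqxx /= ?chic; last exact: val_inj.
    by rewrite add0r; apply/multiplier_parity0; case: ker_subgroup.
  have [d _ dE] := (ker_double Kc _).1 Kac.
  exists (if chi a == 0 then d else badd B d (ginv (badd B) c)).
  move: dE; rewrite iotaD; have [->|->] := Z2_cases (chi a); rewrite ?z0 ?z1 /=.
    by rewrite iota0 => ->; field.
  by rewrite iotaD iotaN => ->; field.
pose g (v : 'Z_2 * T) := badd B (badd B v.2 v.2) (if v.1 == 0 then gid (badd B) else c).
have chiD h : chi (badd B h h) = 0.
  by rewrite multiplier_parityD; have [->|->] := Z2_cases (chi h); apply: val_inj.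
have chi0 : chi (gid (badd B)) = 0.
  by rewrite /chi multiplier0 eqxx.
exists (fun a => (chi a, half a)); split.
  exists g => [a|[e h]].
    apply: iotaI; rewrite /g /= !iotaD [RHS]halfE.
    by have [->|->] := Z2_cases (chi a); rewrite ?z0 ?z1 /= ?iota0; ring.
  have chig : chi (g (e, h)) = e.
    rewrite /g multiplier_parityD chiD add0r /=.
    by have [->|->] := Z2_cases e; rewrite /= ?chi0 ?chic.
  rewrite chig; congr pair; apply: iotaI.
  have := halfE (g (e, h)); rewrite chig /g /= !iotaD.
  have [->|->] := Z2_cases e; rewrite ?z0 ?z1 /= ?iota0 ?mul0r ?mul1r ?addr0 => E;
    apply: (mulIf (isT : 2%:R != 0 :> rat)); rewrite !mulr_natr.
    by rewrite -E mulr2n.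
  by move/addIr: E => <-; rewrite mulr2n.
move=> a b; rewrite /dihedral_op /=.
have cab : chi (bcirc B a b) = chi a + chi b.
  rewrite -multiplier_parityD /chi multiplierD multiplierM.
  by [].
rewrite cab; congr pair; apply: iotaI; rewrite iotaD.
have := halfE (bcirc B a b); rewrite cab circE (halfE a) (halfE b).
rewrite multiplier_parityE.
have z11 : z (1 + 1) = 0 by [].
have [->|->] := Z2_cases (chi a); have [->|->] := Z2_cases (chi b);
  rewrite ?addr0 ?add0r ?z0 ?z1 ?z11 /= ?iotaN; lra.
Qed.

(** When l takes the values 1 and -1, every additive subgroup is a sub-skew brace.
The subgroup generated by h = 3c is not an ideal: the circle conjugate of h by
c is -c. *)
Lemma sign_not_dedekind c : ~ K c -> ~ dedekind B.
Proof.
move=> Kc dB; pose h := badd B c (badd B c c).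
have hE : iota h = 3 * iota c by rewrite /h !iotaD; ring.
pose S := [set b | exists z : int, iota b = z%:~R * iota h].
have sS : sub_skew_brace B S.
  split; split.
  - by exists 0; rewrite iota0 mul0r.
  - by move=> a b [x ax] [y bx]; exists (x + y); rewrite iotaD ax bx intrD mulrDl.
  - by move=> a [x ax]; exists (- x); rewrite iotaN ax intrN mulNr.
  - by exists 0; rewrite circ_gid iota0 mul0r.
  - move=> a b [x ax] [y bx]; rewrite /S /= circE.
    have [->|->] := l_sign a; [exists (x + y)|exists (x - y)];
      by rewrite ax bx ?intrB ?intrD; ring.
  - move=> a [x ax]; rewrite /S /= circ_ginvE.
    have [->|->] := l_sign a; [exists (- x)|exists x];
      by rewrite ax ?intrN; field.
have [_ _ [_ /(_ c h)]] := dB _ sS.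
have lc : l c = -1.
  by have [/ker_lambdaE|] := l_sign c.
have lh : l h = -1 by rewrite /h !multiplierD lc.
case; first by exists 1; rewrite mul1r.
move=> z; rewrite !circE multiplierM circ_ginvE lc lh hE.
have c0 : iota c != 0.
  apply/eqP => c0; apply: Kc; apply/ker_lambdaE.
  rewrite -multiplier0; congr multiplier.
  by apply: iotaI; rewrite c0 iota0.
move=> E; have {E} : (-1)%:~R = (z * 3)%:~R :> rat.
  apply: (mulIf c0); rewrite intrM -[RHS]mulrA -E; by field.
by move/intr_inj; lia.
Qed.

End SignMultiplier.

Lemma ker_ideal : ideal B K.
Proof.
have sK := ker_subgroup.
split; first split=> // a h Kh.
- rewrite (embedded_abelian emb a) -gopA gopV gop1.
  by [].
- by move=> b a; apply: ker_lambda_stable.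
split; first split.
- by rewrite circ_gid; case: sK.
- move=> a b; rewrite !ker_lambdaE multiplierM => -> ->.
  by rewrite mulr1.
- move=> a; rewrite !ker_lambdaE multiplier_inv => ->.
  by rewrite invr1.
- move=> a h; rewrite !ker_lambdaE !multiplierM => ->.
  by rewrite mulr1 multiplierV.
Qed.

Lemma nonzero_ker : ~ trivial_brace B -> K <> [set gid (badd B)] ->
  [/\ ideal B K /\ K <> [set gid (badd B)],
      quotient (badd B) [set: T] K #= `I_2,
      ~ divisible (badd B) 2 [set: T],
      (exists phi : set T -> 'Z_2,
        quotient_iso_Z2 (badd B) [set: T] K phi /\
        forall a b, iota (bcirc B a b) =
          iota a + (-1) ^+ phi (coset (badd B) K a) * iota b) /\
      (exists f : T -> 'Z_2 * T,
        bijective f /\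
        forall a b, f (bcirc B a b) = dihedral_op (badd B) (f a) (f b))
    & ~ dedekind B].
Proof.
move=> nB K0; have sK := ker_subgroup.
have [k Kk k0] : exists2 k, K k & k <> gid (badd B).
  apply: contrapT => nk; apply: K0; apply/seteqP; split=> [k Kk|_ ->]; last by case: sK.
  by apply: contrapT => k0; apply: nk; exists k.
have l_sign a := multiplier_sign a Kk k0.
have [c lc] := multiplier_nontrivial nB.
have Kc : ~ K c by rewrite ker_lambdaE.
have sT : subgroup (badd B) [set: T] by [].
have cG := embedded_abelian emb.
have [phi [phi_iso phiE]] := quotient_iso_of_parity cG sT sK (@subsetT _ _)
  (fun a b _ _ => multiplier_parityD l_sign a b)
  (fun a _ => multiplier_parity0 a) (I : [set: T] c)
  (ltac:(by rewrite /multiplier_parity; case: eqP lc) : multiplier_parity c = 1).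
split.
- by split; first exact: ker_ideal.
- exact: quotient_iso_card phi_iso.
- move=> /(embedded_divisible emb)/(rdivisibleP sX (isT : 2 != 0 :> int)).
  by move=> /(_ _ (iotaX c))/(ker_double l_sign Kc).
- split; last exact: (dihedral_isomorphism l_sign Kc).
  exists phi; split=> // a b.
  by rewrite phiE// -(multiplier_parityE l_sign) circE.
- exact: (sign_not_dedekind l_sign Kc).
Qed.
(** * Skew braces with a zero kernel *)

Section ZeroKernel.
Hypotheses (nB : ~ trivial_brace B) (K0 : K = [set gid (badd B)]).
Local Notation m := (l u).

(** The quotient of a by b in the circle group is in K. *)
Lemma multiplier_inj a b : l a = l b -> a = b.
Proof.
move=> lab; pose c := bcirc B a (ginv (bcirc B) b).
have : K c.
  apply/ker_lambdaE.
  by rewrite multiplierM lab multiplierV.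
rewrite K0 -circ_gid => cE.
by rewrite -(gop1 (bcirc B) a) -(gopVl (bcirc B) b) gopA -/c cE gop1l.
Qed.

Lemma zero_ker_abelian : abelian_law (bcirc B).
Proof.
by move=> a b; apply: multiplier_inj; rewrite !multiplierM mulrC.
Qed.

(** Commutation with the element of image 1 makes the multiplier affine. *)
Lemma zero_ker_multiplier a : l a = 1 + (m - 1) * iota a.
Proof.
have /(congr1 iota) := zero_ker_abelian a u.
by rewrite !circE iu; lra.
Qed.

Lemma zero_ker_circE a b : iota (bcirc B a b) =
  iota a + iota b - iota a * iota b + m * iota a * iota b.
Proof. by rewrite circE zero_ker_multiplier; ring. Qed.

Let m1 := numq m.
Let m2 := denq m.
Let c : rat := (m1 - m2)%:~R / m2%:~R.

Let m2_neq0 : m2 != 0. Proof. exact: denq_neq0. Qed.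

Let m2_rat : m2%:~R != 0 :> rat. Proof. by rewrite intr_eq0. Qed.

Let mE : m = m1%:~R / m2%:~R. Proof. by rewrite divq_num_den. Qed.

Let cE : c = m - 1.
Proof. by rewrite mE /c intrB mulrBl divff. Qed.

Let d_neq0 : m2 - m1 != 0.
Proof.
apply/eqP => d0; have [a] := multiplier_nontrivial nB; apply.
have c0 : c = 0 by rewrite /c -opprB d0 oppr0 mul0r.
by rewrite zero_ker_multiplier -cE c0 mul0r addr0.
Qed.

Let c_neq0 a : range iota a -> 1 + c * a != 0.
Proof.
by case=> {}a _ <-; rewrite cE -zero_ker_multiplier multiplier_neq0.
Qed.

Let c_stable a x : range iota a -> range iota x <-> range iota ((1 + c * a) * x).
Proof.
case=> {}a _ <-; rewrite cE -zero_ker_multiplier.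
exact: range_multiplier.
Qed.

Let X1 : range iota 1. Proof. by exists u. Qed.

Lemma zero_ker_divisible (p : nat) : prime p -> ~~ (p %| m1 - m2)%Z ->
  divisible (badd B) p [set: T].
Proof.
move=> p_pr pd; apply/(embedded_divisible emb)/rdivisibleP => //.
  by rewrite -lt0n prime_gt0.
move=> x; apply: (stable_div_coprime sX X1 m2_neq0 c_neq0 c_stable).
by rewrite coprimezE /= prime_coprime// -dvdzE.
Qed.

Lemma zero_ker_not_divisible : ~ divisible (badd B) (m2 - m1) [set: T].
Proof.
move=> /(embedded_divisible emb)/(rdivisibleP sX d_neq0)/(_ 1 X1).
exact: (stable_not_div sX m2_neq0 c_neq0).
Qed.

Lemma zero_ker_parameters : exists m1 m2 : int,
  let m : rat := m1%:~R / m2%:~R in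
  [/\ m != 0 /\ range iota m,
      [/\ gcdz m1 m2 = 1, 0 < m2 & m2 - m1 \notin [:: 0; 1; -1]],
      (forall p : nat, prime p -> ~~ (p %| m1 - m2)%Z ->
          divisible (badd B) p [set: T]),
      ~ divisible (badd B) (m2 - m1) [set: T]
    & [/\ (forall a, 1 - iota a + m * iota a != 0 /\
              range iota (- iota a / (1 - iota a + m * iota a))),
          (forall a b, range iota ((m2 - m1)%:~R * iota a * iota b))
        & (forall a b, iota (bcirc B a b) =
              iota a + iota b - iota a * iota b + m * iota a * iota b)]].
Proof.
exists m1, m2; rewrite -mE; split.
- by rewrite multiplier_neq0; split.
- split; first by apply/eqP; have := coprime_num_den m.
    exact: denq_gt0.
  rewrite !inE !negb_or d_neq0 /=.
  (* X is divisible by a unit of Z, contrary to the previous lemma. *)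
  have unit_div e : m2 - m1 = e -> e * e = 1 -> False.
    move=> de e1; apply: zero_ker_not_divisible; rewrite de.
    apply/(embedded_divisible emb)/rdivisibleP => //.
      by apply: contraTneq isT => e0; move: e1; rewrite e0.
    have /(congr1 (fun z : int => z%:~R : rat)) := e1; rewrite intrM => e1' x Xx.
    have -> : e%:~R^-1 = e%:~R :> rat.
      have e0 : e%:~R != 0 :> rat.
        by apply/eqP => e0; move: e1'; rewrite e0 mul0r.
      by apply: (mulfI e0); rewrite e1' divff.
    by rewrite mulrC; apply: rsubZ.
  by apply/andP; split; apply/eqP => /unit_div; apply.
- exact: zero_ker_divisible.
- exact: zero_ker_not_divisible.
- split.
  + move=> a; have -> : 1 - iota a + m * iota a = l a.
      by rewrite (zero_ker_multiplier a); ring.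
    by rewrite multiplier_neq0 -circ_ginvE; split.
  + move=> a b; exact: (stable_mul sX m2_neq0 c_stable).
  + exact: zero_ker_circE.
Qed.

Lemma zero_ker_subring : exists (R : set rat) (f : T -> rat),
  [/\ GRing.subring_closed (mem R), injective f, range f = R
    & forall a b, f (badd B a b) = f a + f b].
Proof.
have [e e0 eR] := subring_multiple sX X1 d_neq0
  (@stable_mul _ _ _ sX m2_neq0 c_stable).
have e0' : e%:R != 0 :> rat by rewrite pnatr_eq0 -lt0n.
exists [set e%:R * x | x in range iota], (fun a => e%:R * iota a).
split; first exact: eR.
- by move=> a b /(mulfI e0')/iotaI.
- apply/seteqP; split=> [_ [a _ <-]|_ [_ [a _ <-] <-]].
    by exists (iota a).
  by exists a.
- by move=> a b; rewrite iotaD mulrDr.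
Qed.

(** Let p be a prime not dividing n = m1 - m2, and S the set of the a such that c a
has positive p-adic valuation.  It is a sub-skew brace because, with x = c a
and y = c b, the circle law becomes x + y + x y.  The element s = p m2, for
which c s = p n, is in S; but lambda_b(s) is not when b = m2 / p, since
multiplication by c turns it into n (p + n). *)
Lemma zero_ker_not_dedekind : ~ dedekind B.
Proof.
move=> dB; pose n : int := m1 - m2.
have n0 : n != 0 by rewrite -oppr_eq0 opprB.
have [p np p_pr] := prime_above `|n|%N.
have pn : ~~ (p %| n)%Z.
  by rewrite dvdzE gtnNdvd// ?absz_gt0.
have Ep (k1 k2 : int) : ~~ (p %| k1)%Z -> ~~ (p %| k2)%Z -> ~~ (p %| k1 * k2)%Z.
  by rewrite !dvdzE abszM Euclid_dvdM// negb_or => -> ->.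
(* The rationals of positive p-adic valuation. *)
pose D := [set x : rat | exists2 k : int, ~~ (p %| k)%Z &
   exists y : int, x * k%:~R = (y * p)%:~R].
have DD x y : D x -> D y -> D (x + y).
  move=> [k pk [i xk]] [k' pk' [j yk]]; exists (k * k'); first exact: Ep.
  exists (i * k' + j * k); rewrite mulrDl intrM mulrA xk mulrCA yk.
  by rewrite -!intrM -intrD; congr _%:~R; ring.
have DZ x y : D x -> D y -> D (x * y).
  move=> [k pk [i xk]] [k' pk' [j yk]]; exists (k * k'); first exact: Ep.
  exists (i * j * p); rewrite intrM mulrACA xk yk.
  by rewrite -!intrM; congr _%:~R; ring.
have DN x : D x -> D (- x).
  by move=> [k pk [i xk]]; exists k => //; exists (- i); rewrite mulNr xk mulNr intrN.
have D0 : D 0.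
  exists 1; first by rewrite dvdzE/= Euclid_dvd1.
  by exists 0; rewrite !mul0r.
have DV x : D x -> 1 + x != 0 -> D (- x / (1 + x)).
  move=> [k pk [i xk]] x1; exists (k + i * p).
    by rewrite rpredDr ?dvdz_mull.
  exists (- i); have : (1 + x) * k%:~R = (k + i * p)%:~R.
    by rewrite mulrDl mul1r xk intrD.
  by move=> <-; rewrite [in RHS]mulNr intrN -xk; field.
pose S := [set a | D (c * iota a)].
have sS : sub_skew_brace B S.
  split; split=> [|a b Sa Sb|a Sa]; rewrite /S /=.
  - by rewrite iota0 mulr0.
  - by rewrite iotaD mulrDr; apply: DD.
  - by rewrite iotaN mulrN; apply: DN.
  - by rewrite circ_gid iota0 mulr0.
  - rewrite circE zero_ker_multiplier -cE.
    have -> : c * (iota a + (1 + c * iota a) * iota b) =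
      c * iota a + c * iota b + c * iota a * (c * iota b) by ring.
    by apply: (DD _ _); [apply: DD|apply: DZ].
  - rewrite circ_ginvE zero_ker_multiplier -cE mulrA mulrN.
    by apply: DV => //; apply: c_neq0.
have pX : range iota (m2%:~R * (1 / p%:~R)).
  apply: rsubZ => //; apply: (stable_div_coprime sX X1 m2_neq0 c_neq0 c_stable) => //.
  by rewrite coprimezE /= prime_coprime// -dvdzE.
have [b _ bE] := pX.
have [s _ sE] : range iota ((m2 * p)%:~R).
  by rewrite -[_%:~R]mulr1; apply: rsubZ.
have Ss : S s.
  exists 1; first by rewrite dvdzE/= Euclid_dvd1.
  exists n; rewrite sE mulr1 /c -/n !intrM.
  by field.
have [_ /(_ b _ Ss) + _] := dB _ sS; rewrite /S /=.
rewrite lambdaE zero_ker_multiplier -cE => -[k pk [y]].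
have p0 : p%:~R != 0 :> rat by rewrite intr_eq0 -lt0n prime_gt0.
rewrite bE sE => E; have {E} : (n * (p%:Z + n) * k)%:~R = (y * p)%:~R :> rat.
  rewrite -E !intrM intrD /c -/n; field.
  by rewrite p0.
move=> /intr_inj E; have : (p %| n * (p%:Z + n) * k)%Z by rewrite E dvdz_mull.
apply/negP; rewrite Ep ?Ep//.
by rewrite rpredDl.
Qed.

End ZeroKernel.
End EmbeddedBrace.

(** * Skew braces from multipliers *)

(** The function k plays the role of the multiplier; kM is the associativity of
the circle law, and kV says that the inverse - x / k(x) is in X. *)
Section BraceFromMultiplier.
Variables (X : set rat) (k : rat -> rat).
Hypotheses (sX : subgroup (zmodLaw rat) X) (X1 : X 1).
Hypotheses (kX : forall x y, X x -> X y -> X (k x * y)).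
Hypothesis k_neq0 : forall x, X x -> k x != 0.
Hypothesis kV : forall x, X x -> X (- x / k x).
Hypothesis kM : forall x y, X x -> X y -> k (x + k x * y) = k x * k y.

Lemma sub_groupLaw (op : rat -> rat -> rat) (inv : rat -> rat) :
  (forall x y, X x -> X y -> X (op x y)) -> (forall x, X x -> X (inv x)) ->
  (forall x y z, X x -> X y -> X z -> op x (op y z) = op (op x y) z) ->
  (forall x, X x -> op 0 x = x) -> (forall x, X x -> op (inv x) x = 0) ->
  exists G : groupLaw X,
    \val (gid G) = 0 /\ forall x y : X, \val (G x y) = op (\val x) (\val y).
Proof.
move=> Xop Xinv opA op0 opV.
have XP (x : X) : X (\val x) by apply: set_mem; apply: valP.
pose o (x y : X) : X := exist (fun x => x \in X) _ (mem_set (Xop _ _ (XP x) (XP y))).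
pose e : X := exist (fun x => x \in X) _ (mem_set (rsub0 sX)).
pose i (x : X) : X := exist (fun x => x \in X) _ (mem_set (Xinv _ (XP x))).
have oA : associative o by move=> x y z; apply: val_inj; rewrite /= opA//; apply: XP.
have oe : left_id e o by move=> x; apply: val_inj; rewrite /= op0//; apply: XP.
have oi : left_inverse e i o by move=> x; apply: val_inj; rewrite /= opV//; apply: XP.
by exists (GroupLaw oA oe oi); split.
Qed.

Lemma multiplier_brace : exists B : skewBrace X,
  [/\ forall x y : X, \val (badd B x y) = \val x + \val y,
      forall x y : X, \val (bcirc B x y) = \val x + k (\val x) * \val y
    & [set \val x | x in ker_lambda B] = [set x | X x /\ k x = 1]].
Proof.
have X0 := rsub0 sX.
have XP (x : X) : X (\val x) by apply: set_mem; apply: valP.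
have k0 : k 0 = 1.
  by apply: (mulfI (k_neq0 X0)); rewrite -kM// mulr0 addr0 mulr1.
have kinv x : X x -> k (- x / k x) = (k x)^-1.
  move=> Xx; apply: (mulfI (k_neq0 Xx)); rewrite divff ?k_neq0//.
  rewrite -kM//; last exact: kV.
  by rewrite mulrC divfK ?k_neq0// subrr.
have [G [G0 GE]] : exists G : groupLaw X, \val (gid G) = 0 /\
    forall x y : X, \val (G x y) = \val x + \val y.
  apply: (@sub_groupLaw +%R -%R) => [x y|x|x y z _ _ _|x _|x _].
  - exact: rsubD.
  - exact: rsubN.
  - exact: addrA.
  - exact: add0r.
  - exact: addNr.
have [C [C0 CE]] : exists C : groupLaw X, \val (gid C) = 0 /\
    forall x y : X, \val (C x y) = \val x + k (\val x) * \val y.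
  apply: (@sub_groupLaw (fun x y => x + k x * y) (fun x => - x / k x)).
  - by move=> x y Xx Xy; apply: rsubD => //; apply: kX.
  - by move=> x; apply: kV.
  - by move=> x y z Xx Xy Xz; rewrite kM//; ring.
  - by move=> x _; rewrite k0; ring.
  - by move=> x Xx; rewrite kinv//; field; apply: k_neq0.
have GC a b c : C a (G b c) = G (G (C a b) (ginv G a)) (C a c).
  apply: val_inj; rewrite !(GE, CE) (morph_ginv GE); ring.
exists (SkewBrace GC); split=> //; apply/seteqP; split=> [_ [x Kx <-]|x [Xx kx]].
  split; first exact: XP.
  pose u : X := exist (fun x => x \in X) 1 (mem_set X1).
  have /(congr1 val) := Kx u; rewrite /lambda /= GE CE (morph_ginv GE) /=.
  by rewrite mulr1; lra.
exists (exist (fun x => x \in X) x (mem_set Xx)) => // y; apply: val_inj.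
by rewrite /lambda /= GE CE (morph_ginv GE) /= kx; ring.
Qed.

End BraceFromMultiplier.

(** * The skew braces whose multiplier is a sign *)

Section HalfParity.
Variable X : set rat.
Hypotheses (sX : subgroup (zmodLaw rat) X) (X1 : X 1).
Local Notation X2 := (multiples (zmodLaw rat) 2 X).

Lemma double_subgroup : subgroup (zmodLaw rat) X2.
Proof.
split=> [|x y|x]; rewrite !rdoubleE /=.
- by rewrite mul0r; apply: rsub0.
- by rewrite mulrDl; apply: rsubD.
- by rewrite mulNr; apply: rsubN.
Qed.

Lemma double_sub : X2 `<=` X.
Proof.
move=> x /rdoubleE Xx; have -> : x = x / 2 + x / 2 by field.
exact: rsubD.
Qed.

(** The parity of x is 0 when x is in 2X and 1 otherwise; it is additive since 2X has
index 2. *)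
Lemma quotient_double : ~ divisible (zmodLaw rat) 2 X ->
  exists phi, quotient_iso_Z2 (zmodLaw rat) X X2 phi.
Proof.
move=> ndX; have [c [Xc c2]] : exists c, X c /\ ~ X (c / 2).
  apply: contrapT => /forallNP nX; apply: ndX; apply/(rdivisibleP sX) => // x Xx.
  by apply: contrapT => x2; apply: (nX x).
pose chi x : 'Z_2 := if `[< X (x / 2) >] then 0 else 1.
have chi0 x : X (x / 2) <-> chi x = 0 by rewrite /chi; case: asboolP.
have [phi [phi_iso _]] : exists phi, quotient_iso_Z2 (zmodLaw rat) X X2 phi /\
    forall x, X x -> phi (coset (zmodLaw rat) X2 x) = chi x.
  apply: (@quotient_iso_of_parity _ _ _ _ _ sX double_subgroup double_sub chi c) => //.
  - exact: addrC.
  - move=> x y Xx Xy /=; rewrite /chi; case: (asboolP (X (x / 2))) => x2.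
      rewrite add0r; congr (if _ then _ else _); apply/asbool_equiv_eq.
      rewrite mulrDl; split=> [/(rsubB sX) /(_ x2)|]; last exact: rsubD.
      by rewrite addrAC subrr add0r.
    case: (asboolP (X (y / 2))) => y2.
      rewrite addr0; case: asboolP => // xy2; case: x2.
      have -> : x / 2 = (x + y) / 2 - y / 2 by field.
      exact: rsubB.
    case: asboolP => [_|[]]; first exact: val_inj.
    exact: rdouble_index2.
  - by move=> x Xx; rewrite -chi0 rdoubleE.
  - by rewrite /chi; case: asboolP.
by exists phi.
Qed.

Lemma parity_brace phi : quotient_iso_Z2 (zmodLaw rat) X X2 phi ->
  exists B : skewBrace X,
    [/\ (forall x y : X, \val (badd B x y) = \val x + \val y),
        (forall x y : X, \val (bcirc B x y) =
          \val x + (-1) ^+ phi (coset (zmodLaw rat) X2 (\val x)) * \val y),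
        [set \val x | x in ker_lambda B] = X2
      & X2 <> [set 0]].
Proof.
move=> /(quotient_iso_parity (@addrC rat : abelian_law (zmodLaw rat)) sX double_subgroup) [].
set p := fun x => phi (coset (zmodLaw rat) X2 x) => pD p0.
pose k x : rat := (-1) ^+ p x.
have k1 x : X x -> X2 x <-> k x = 1.
  by move=> Xx; rewrite p0// -/(p x) /k; have [->|->] := Z2_cases (p x).
have kD x y : X x -> X y -> k (x + y) = k x * k y.
  move=> Xx Xy; rewrite /k {1}/p pD// -/(p x) -/(p y).
  by have [->|->] := Z2_cases (p x); have [->|->] := Z2_cases (p y).
have k_sign x : k x = 1 \/ k x = -1.
  by rewrite /k; have [->|->] := Z2_cases (p x); [left|right].
have kN x : X x -> k (- x) = k x.
  move=> Xx; have := kD _ _ Xx (rsubN sX Xx).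
  rewrite subrr (k1 0 (rsub0 sX)).1; last by case: double_subgroup.
  by have [->|->] := k_sign x; have [->|->] := k_sign (- x).
have [B [BD BC BK]] : exists B : skewBrace X,
  [/\ forall x y : X, \val (badd B x y) = \val x + \val y,
      forall x y : X, \val (bcirc B x y) = \val x + k (\val x) * \val y
    & [set \val x | x in ker_lambda B] = [set x | X x /\ k x = 1]].
  apply: multiplier_brace => // [x y _ Xy|x _|x Xx|x y Xx Xy].
  - by have [->|->] := k_sign x; rewrite ?mul1r ?mulN1r//; apply: rsubN.
  - by rewrite expf_neq0.
  - have [->|->] := k_sign x; first by rewrite divr1; apply: rsubN.
    by rewrite invrN1 mulrN1 opprK.
  - have [kx|kx] := k_sign x; rewrite kx ?mul1r ?mulN1r kD// ?kx ?mul1r ?mulN1r//.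
      by rewrite kN.
    exact: rsubN.
exists B; split=> //.
  rewrite BK; apply/seteqP; split=> [x [Xx /k1]|x X2x]; first exact.
  by split; [exact: double_sub|apply/k1 => //; exact: double_sub].
move=> X20; have : X2 2 by apply/rdoubleE; rewrite divff.
by rewrite X20.
Qed.

End HalfParity.

(** * The skew braces whose multiplier is affine *)

Section SubringBrace.
Variables (X : set rat) (m1 m2 : int).
Let c : rat := (m1 - m2)%:~R / m2%:~R.
Hypotheses (sX : subgroup (zmodLaw rat) X) (X1 : X 1).
Hypothesis XM : forall x y, X x -> X y -> X (x * y).
Hypotheses (m12 : gcdz m1 m2 = 1) (m2_gt0 : 0 < m2).
Hypothesis X_div : forall p : nat, prime p -> ~~ (p %| m1 - m2)%Z ->
  X (p%:R^-1).
Hypothesis X_ndiv : ~ X ((m1 - m2)%:~R^-1).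

(** In a subring, the inverse of a product of primes is the product of their
inverses. *)
Lemma subring_inv (n : int) : n != 0 ->
  (forall p : nat, prime p -> (p %| n)%Z -> X (p%:R^-1)) -> X (n%:~R^-1).
Proof.
move=> n0 Xp; suff Xn : X (`|n|%N%:R^-1).
  move: Xn; rewrite pmulrn abszE; have [//|_] := ger0P n.
  by rewrite intrN invrN => /(rsubN sX); rewrite opprK.
have {n0} n0 : (0 < `|n|)%N by rewrite absz_gt0.
have {}Xp p : prime p -> (p %| `|n|)%N -> X (p%:R^-1) by move=> *; apply: Xp.
move: `|n|%N n0 Xp => {n} n; have [k nk] := ubnP n.
elim: k n nk => // k IHk n nk n0 Xp.
have [n1|n1] := leqP n 1.
  by have -> : n = 1%N by apply/eqP; rewrite eqn_leq n1.
have p_pr := pdiv_prime n1; have pn := pdiv_dvd n.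
rewrite -(divnK pn) natrM invfM; apply: XM; last exact: Xp.
have q0 : (0 < n %/ pdiv n)%N by rewrite divn_gt0 ?prime_gt0// dvdn_leq.
apply: IHk => //.
  by apply: (@leq_trans n) => //; rewrite ltn_Pdiv ?prime_gt1.
by move=> p pp pd; apply: Xp => //; apply: dvdn_trans pd _; apply: dvdn_div.
Qed.

Let m2_rat : m2%:~R != 0 :> rat. Proof. by rewrite intr_eq0 gt_eqF. Qed.

Let dvd_m2 (p : nat) : prime p -> (p %| m2)%Z -> ~~ (p %| m1 - m2)%Z.
Proof.
move=> p_pr pm2; rewrite rpredBr//; apply/negP => pm1.
have : (p %| gcdz m1 m2)%Z by rewrite dvdz_gcd pm1.
by rewrite m12 dvdzE /= Euclid_dvd1.
Qed.

Let d_neq0 : m1 - m2 != 0.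
Proof.
apply/eqP => d0; have m1E : m1 = m2 by lia.
apply: X_ndiv; rewrite d0 invr0; exact: rsub0.
Qed.

Let d_rat : (m1 - m2)%:~R != 0 :> rat. Proof. by rewrite intr_eq0. Qed.

(** The primes dividing m2 do not divide m1 - m2, so 1 / m2 is in X. *)
Lemma subring_slope : X c.
Proof.
apply: XM; first by rewrite -[_%:~R]mulr1; apply: rsubZ.
apply: subring_inv => [|p p_pr pm]; first by rewrite gt_eqF.
by apply: X_div => //; apply: dvd_m2.
Qed.

(** A zero of 1 + c x would be m2 / (m2 - m1); as m2 and m1 - m2 are coprime, X would
contain 1 / (m1 - m2). *)
Lemma subring_unit x : X x -> 1 + c * x != 0.
Proof.
move=> Xx; apply/eqP => cx; apply: X_ndiv.
apply: (@rsub_coprime _ sX m2 (m1 - m2)).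
- rewrite /coprimez; have [u [v uv]] := Bezoutz m1 m2.
  (* (u + v) m2 + u (m1 - m2) = u m1 + v m2 *)
  apply/coprimezP; exists (u + v, u) => /=; rewrite -m12 -uv; ring.
- have -> : m2%:~R * (m1 - m2)%:~R^-1 = - x; last exact: rsubN.
  apply: (mulfI d_rat); rewrite mulrCA divff// mulr1.
  apply/eqP; rewrite -subr_eq0 mulrN opprK.
  have -> : m2%:~R + (m1 - m2)%:~R * x = m2%:~R * (1 + c * x) :> rat.
    by rewrite /c; field.
  by rewrite cx mulr0.
- by rewrite divff.
Qed.

(** With x = r / s in lowest terms, the denominator is D = m2 s + (m1 - m2) r up to a
factor.  A prime p dividing D either does not divide m1 - m2, and is inverted
in X by divisibility; or it divides m1 - m2, hence not m2, hence it divides s,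
and 1 / s is in X because r and s are coprime. *)
Lemma subring_quasi_inverse x : X x -> X (- x / (1 + c * x)).
Proof.
move=> Xx; pose r := numq x; pose s := denq x.
have rs : coprimez r s by rewrite coprimezE coprime_num_den.
have s0 : s%:~R != 0 :> rat by rewrite intr_eq0 denq_neq0.
have xE : x = r%:~R / s%:~R by rewrite divq_num_den.
clearbody r s.
have Xs : X (s%:~R^-1).
  apply: (@rsub_coprime _ sX r s); rewrite -?xE ?divff//.
pose D := m2 * s + (m1 - m2) * r.
have DE : D%:~R = m2%:~R * s%:~R + (m1 - m2)%:~R * r%:~R :> rat.
  by rewrite /D [LHS]intrD [in LHS]intrM [X in _ + X = _]intrM.
have cxE : 1 + c * x = D%:~R / (m2%:~R * s%:~R).
  by rewrite DE xE /c; field; rewrite s0.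
have D0 : D%:~R != 0 :> rat.
  by have := subring_unit Xx; rewrite cxE !mulf_eq0 negb_or => /andP[].
have -> : - x / (1 + c * x) = (- (m2 * r))%:~R * D%:~R^-1.
  by rewrite cxE xE intrN intrM; field; rewrite m2_rat s0 D0.
apply: rsubZ => //; apply: subring_inv => [|p p_pr pD].
  by rewrite -(intr_eq0 rat).
have [pd|] := boolP (p %| m1 - m2)%Z; last exact: X_div.
have : (p %| m2 * s)%Z by move: pD; rewrite rpredDr// dvdz_mulr.
rewrite dvdzE abszM Euclid_dvdM// -!dvdzE => /orP[/(dvd_m2 p_pr)|].
  by rewrite pd.
move=> /dvdzP[q sE].
have -> : p%:R^-1 = q%:~R * s%:~R^-1 :> rat.
  have p0 : p%:R != 0 :> rat by rewrite pnatr_eq0 -lt0n prime_gt0.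
  move: s0; rewrite sE intrM mulf_eq0 negb_or => /andP[q0 _].
  by rewrite invfM mulrA divff// mul1r.
exact: rsubZ.
Qed.

Lemma subring_brace : exists B : skewBrace X,
  [/\ (forall x y : X, \val (badd B x y) = \val x + \val y),
      (forall x y : X, \val (bcirc B x y) =
        \val x + \val y - \val x * \val y
        + m1%:~R / m2%:~R * \val x * \val y),
      abelian_law (bcirc B)
    & ker_lambda B = [set gid (badd B)]].
Proof.
have mE : m1%:~R / m2%:~R = 1 + c by rewrite /c intrB; field.
have Xc := subring_slope.
have [B [BD BC BK]] : exists B : skewBrace X,
  [/\ forall x y : X, \val (badd B x y) = \val x + \val y,
      forall x y : X, \val (bcirc B x y) = \val x + (1 + c * \val x) * \val y
    & [set \val x | x in ker_lambda B] = [set x | X x /\ 1 + c * x = 1]].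
  apply: (@multiplier_brace X (fun x => 1 + c * x)) => // [x y Xx Xy|x Xx|x Xx|x y _ _].
  - by rewrite mulrDl mul1r; apply: rsubD => //; apply: XM => //; apply: XM.
  - exact: subring_unit.
  - exact: subring_quasi_inverse.
  - ring.
have c0 : c != 0 by rewrite mulf_neq0 ?invr_neq0.
exists B; split=> //.
- by move=> x y; rewrite BC mE; ring.
- by move=> x y; apply: val_inj; rewrite /= !BC; ring.
apply/seteqP; split=> x.
  move=> Kx; have : [set \val y | y in ker_lambda B] (\val x) by exists x.
  rewrite BK => -[_ cx]; apply: val_inj; rewrite (morph_gid BD).
  by apply: (mulfI c0); rewrite mulr0; lra.
move=> ->; have : [set \val y | y in ker_lambda B] 0.
  by rewrite BK /= mulr0 addr0; split=> //; apply: rsub0.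
case=> y Ky y0; suff -> : gid (badd B) = y by [].
by apply: val_inj; rewrite (morph_gid BD).
Qed.

End SubringBrace.

(** * Classification *)

Theorem theorem4p7 :
  (forall (T : Type) (B : skewBrace T),
    ~ trivial_brace B ->
    locally_cyclic (badd B) ->
    torsion_free (badd B) ->
    let K := ker_lambda B in
    (exists iota : T -> rat, rat_embedding (badd B) iota) /\
    (forall iota : T -> rat, rat_embedding (badd B) iota ->
      [/\ ideal B K /\ K <> [set gid (badd B)],
          quotient (badd B) [set: T] K #= `I_2,
          ~ divisible (badd B) 2 [set: T],
          (exists phi : set T -> 'Z_2,
            quotient_iso_Z2 (badd B) [set: T] K phi /\
            forall a b, iota (bcirc B a b) =
              iota a + (-1) ^+ phi (coset (badd B) K a) * iota b) /\
          (exists f : T -> 'Z_2 * T,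
            bijective f /\
            forall a b, f (bcirc B a b) = dihedral_op (badd B) (f a) (f b))
        & ~ dedekind B]
      \/
      [/\ K = [set gid (badd B)],
          abelian_law (bcirc B),
          (exists m1 m2 : int,
            let m : rat := m1%:~R / m2%:~R in
            [/\ m != 0 /\ range iota m,
                [/\ gcdz m1 m2 = 1, 0 < m2
                  & m2 - m1 \notin [:: 0; 1; -1]],
                (forall p : nat, prime p -> ~~ (p %| m1 - m2)%Z ->
                  divisible (badd B) p [set: T]),
                ~ divisible (badd B) (m2 - m1) [set: T]
              & [/\ (forall a, 1 - iota a + m * iota a != 0 /\
                      range iota (- iota a / (1 - iota a + m * iota a))),
                    (forall a b,
                      range iota ((m2 - m1)%:~R * iota a * iota b))
                  & (forall a b, iota (bcirc B a b) =
                      iota a + iota b - iota a * iota b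
                      + m * iota a * iota b)]]),
          (exists (R : set rat) (f : T -> rat),
            [/\ GRing.subring_closed (mem R), injective f, range f = R
              & forall a b, f (badd B a b) = f a + f b])
        & ~ dedekind B]))
  /\
  (forall X : set rat, subgroup (zmodLaw rat) X -> X 1 ->
    (~ divisible (zmodLaw rat) 2 X ->
      let X2 := multiples (zmodLaw rat) 2 X in
      (exists phi, quotient_iso_Z2 (zmodLaw rat) X X2 phi) /\
      (forall phi, quotient_iso_Z2 (zmodLaw rat) X X2 phi ->
        exists B : skewBrace X,
          [/\ (forall x y : X, \val (badd B x y) = \val x + \val y),
              (forall x y : X, \val (bcirc B x y) =
                \val x + (-1) ^+ phi (coset (zmodLaw rat) X2 (\val x)) * \val y),
              [set \val x | x in ker_lambda B] = X2
            & X2 <> [set 0]]))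
    /\
    (GRing.subring_closed (mem X) ->
      forall m1 m2 : int,
        let m : rat := m1%:~R / m2%:~R in
        m != 0 ->
        [/\ gcdz m1 m2 = 1, 0 < m2 & m2 - m1 \notin [:: 0; 1; -1]] ->
        (forall p : nat, prime p -> ~~ (p %| m1 - m2)%Z ->
          divisible (zmodLaw rat) p X) ->
        ~ divisible (zmodLaw rat) (m2 - m1) X ->
        exists B : skewBrace X,
          [/\ (forall x y : X, \val (badd B x y) = \val x + \val y),
              (forall x y : X, \val (bcirc B x y) =
                \val x + \val y - \val x * \val y + m * \val x * \val y),
              abelian_law (bcirc B)
            & ker_lambda B = [set gid (badd B)]])).
Proof.
split=> [T B nB lcB tfB K|X sX X1].
  split.
    suff [g g0] : exists g, g <> gid (badd B).
      exact: locally_cyclic_rat_embedding lcB tfB g0.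
    apply: contrapT => /forallNP all0; apply: nB => a b.
    by rewrite (contrapT (all0 (badd B a b))) (contrapT (all0 (bcirc B a b))).
  move=> iota emb; have [_ _ [u _ iu]] := emb.
  have [K0|K0] := pselect (K = [set gid (badd B)]); [right|left].
    split=> //.
    - exact: (zero_ker_abelian emb iu K0).
    - exact: (zero_ker_parameters emb iu nB K0).
    - exact: (zero_ker_subring emb iu nB K0).
    - exact: (zero_ker_not_dedekind emb iu nB K0).
  exact: (nonzero_ker emb iu nB K0).
split=> [ndX X2|ringX m1 m2 m m0 [m12 m2_gt0 m_unit] X_div X_ndiv].
  split; first exact: quotient_double.
  by move=> phi; apply: parity_brace.
have XM x y : X x -> X y -> X (x * y).
  by case: ringX => _ _ XM Xx Xy; have := XM x y; rewrite !inE; apply.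
have d0 : m2 - m1 != 0 by move: m_unit; rewrite !inE !negb_or => /andP[].
apply: subring_brace => // [p p_pr pm|Xd].
  have p0 : Posz p != 0 by rewrite -lt0n prime_gt0.
  by have /(rdivisibleP sX p0)/(_ 1 X1) := X_div p p_pr pm; rewrite mul1r.
apply: X_ndiv; apply/(rdivisibleP sX d0) => x Xx; apply: XM => //.
by rewrite -opprB intrN invrN; apply: rsubN.
Qed.
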